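(* Fix a nonzero vector $\mathbf{x}\in\mathbf{R}^2$. Let $G'_+$ be the set of real matrices $A=\begin{pmatrix}a&b\\c&d\end{pmatrix}$, viewed as points of $\mathbf{R}^4$ with coordinates $(a,b,c,d)$, satisfying $$(a-d)^2+4bc<0,\qquad \tfrac12\big((a-d)^2+(b+c)^2\big)<1,\qquad \tfrac12\big((a+d)^2+(b-c)^2\big)<1,$$ and such that the rotation angle $\alpha=\alpha(A)$ of the orthogonal factor in the polar decomposition of $A$ can be taken in $[0,\pi]$; take $\alpha(A)\in[0,\pi]$. For $A\in G'_+$ let $\gamma(A)$ be the oriented angle from $\mathbf{x}$ to $A\mathbf{x}$, normalized to lie in $(\alpha(A)-\pi,\alpha(A)+\pi]$, and let $$\bar\gamma=\frac{\int_{G'_+}\gamma(A)\,dv}{\int_{G'_+}dv}$$ be the mean value of the rotation angle of operators with complex spectrum, where $dv$ is Lebesgue measure on $\mathbf{R}^4$. Then $$\frac{\pi}{2}-\frac{2}{\pi}\leqslant\bar\gamma\leqslant\frac{\pi}{2}+\frac{2}{\pi}.$$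
   Context: $\mathbf{R}^2$ is the standard Euclidean plane. An operator with matrix $A$ has complex spectrum if its characteristic roots are non-real complex conjugates, equivalently $(a-d)^2+4bc<0$; then $\det A>0$. The polar decomposition of such an $A$ is $A=OB$, where $B$ is symmetric positive definite with $B^2=A^{\mathrm t}A$ and $O=\begin{pmatrix}\cos\alpha&-\sin\alpha\\ \sin\alpha&\cos\alpha\end{pmatrix}$; $\alpha$ is the rotation angle of the orthogonal factor. The oriented angle from a nonzero vector $\mathbf{x}$ to a nonzero vector $\mathbf{y}$ is the angle (modulo $2\pi$) of the counterclockwise rotation taking the direction of $\mathbf{x}$ to the direction of $\mathbf{y}$. Both $\alpha(A)$ and $\gamma(A)$ are unchanged when $A$ is multiplied by a positive scalar; the mean over all operators with complex spectrum (a domain of infinite volume) is by convention computed over the bounded domain above. In the orthonormal coordinates $x,y,z,t$ on $\mathbf{R}^4$ defined by $a=\frac{x+t}{\sqrt2}$, $b=\frac{y+z}{\sqrt2}$, $c=\frac{y-z}{\sqrt2}$, $d=\frac{t-x}{\sqrt2}$, the three displayed inequalities read $x^2+y^2<z^2$, $x^2+y^2<1$, $z^2+t^2<1$. *)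

(* Defs.v *)
From HB Require Import structures.
From mathcomp Require Import all_boot all_order all_algebra.
From mathcomp Require Import all_classical all_reals all_analysis.

Set Implicit Arguments.
Unset Strict Implicit.
Unset Printing Implicit Defensive.

Import Order.TTheory GRing.Theory Num.Theory.
Import numFieldNormedType.Exports.

Local Open Scope classical_set_scope.
Local Open Scope ring_scope.

Definition mx2 {R : realType} (a b c d : R) : 'M[R]_2 :=
  \matrix_(i < 2, j < 2)
    (if i == 0 then (if j == 0 then a else b) else (if j == 0 then c else d)).

Definition rot2 {R : realType} (t : R) : 'M[R]_2 :=
  mx2 (cos t) (- sin t) (sin t) (cos t).

(* The point ((a, b), (c, d)) of R^4 stands for the matrix with rows (a, b) and
   (c, d). *)
Notation R4 R := ((measurableTypeR R * measurableTypeR R) *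
                  (measurableTypeR R * measurableTypeR R))%type.

Definition mx_of {R : realType} (v : R4 R) : 'M[R]_2 :=
  mx2 v.1.1 v.1.2 v.2.1 v.2.2.

(* The library does not infer sigma-finiteness of a product of sigma-finite
   measures, which iterating the product requires. *)
Lemma sigma_finite_product d1 d2 (T1 : measurableType d1)
    (T2 : measurableType d2) (R : realType)
    (m1 : {sigma_finite_measure set T1 -> \bar R})
    (m2 : {sigma_finite_measure set T2 -> \bar R}) :
  sigma_finite setT (m1 \x m2)%E.
Proof.
have /sigma_finiteP[F [TF ndF Foo]] := sigma_finiteT m1.
have /sigma_finiteP[G [TG ndG Goo]] := sigma_finiteT m2.
exists (fun n => F n `*` G n).
  rewrite -setXTT TF TG predeqE => -[x y]; split.
    move=> [/= [n _ Fnx] [k _ Gky]]; exists (maxn n k) => //; split.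
    - by move: x Fnx; exact/subsetPset/ndF/leq_maxl.
    - by move: y Gky; exact/subsetPset/ndG/leq_maxr.
  by move=> [n _ []/= ? ?]; split; exists n.
move=> k; have [? ?] := Foo k; have [? ?] := Goo k.
split; first exact: measurableX.
by rewrite product_measure1E// lte_mul_pinfty// ge0_fin_numE.
Qed.

Definition lebesgue2 (R : realType) :
    set (measurableTypeR R * measurableTypeR R) -> \bar R :=
  (@lebesgue_measure R \x @lebesgue_measure R)%E.
HB.instance Definition _ (R : realType) := Measure.on (@lebesgue2 R).
HB.instance Definition _ (R : realType) :=
  Measure_isSigmaFinite.Build _ _ _ (@lebesgue2 R)
    (sigma_finite_product (@lebesgue_measure R) (@lebesgue_measure R)).

Definition lebesgue4 (R : realType) : set (R4 R) -> \bar R :=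
  (@lebesgue2 R \x @lebesgue2 R)%E.
HB.instance Definition _ (R : realType) := Measure.on (@lebesgue4 R).
HB.instance Definition _ (R : realType) :=
  Measure_isSigmaFinite.Build _ _ _ (@lebesgue4 R)
    (sigma_finite_product (@lebesgue2 R) (@lebesgue2 R)).

Definition sym_posdef {R : realType} (B : 'M[R]_2) : Prop :=
  B^T = B /\ forall u : 'cV[R]_2, u != 0 -> 0 < (u^T *m B *m u) 0 0.

Definition is_polar_angle {R : realType} (A : 'M[R]_2) (alpha : R) : Prop :=
  exists B : 'M[R]_2,
    [/\ sym_posdef B, B *m B = A^T *m A & A = rot2 alpha *m B].

(* For nonzero x and y only: g represents the oriented angle from x to y, an
   element of R / 2 pi Z.  Equality of directions is equality up to a positive
   factor. *)
Definition is_oriented_angle {R : realType} (x y : 'cV[R]_2) (g : R) : Prop :=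
  exists2 k : R, 0 < k & y = k *: (rot2 g *m x).

Definition Gplus {R : realType} : set (R4 R) :=
  [set v | let: ((a, b), (c, d)) := v in
    [/\ (a - d) ^+ 2 + 4 * b * c < 0,
        2^-1 * ((a - d) ^+ 2 + (b + c) ^+ 2) < 1,
        2^-1 * ((a + d) ^+ 2 + (b - c) ^+ 2) < 1
      & exists2 alpha : R, 0 <= alpha <= pi & is_polar_angle (mx_of v) alpha]].

(* On Gplus, for x != 0, the sets below are singletons: get is a definite
   description; its value elsewhere is irrelevant. *)
Definition polar_angle {R : realType} (A : 'M[R]_2) : R :=
  get [set alpha : R | 0 <= alpha <= pi /\ is_polar_angle A alpha].

Definition turn_angle {R : realType} (x : 'cV[R]_2) (A : 'M[R]_2) : R :=
  get [set g : R | polar_angle A - pi < g <= polar_angle A + pi /\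
                   is_oriented_angle x (A *m x) g].

Definition mean_turn_angle {R : realType} (x : 'cV[R]_2) : R :=
  (\int[@lebesgue4 R]_(v in @Gplus R) turn_angle x (mx_of v)) /
  (\int[@lebesgue4 R]_(v in @Gplus R) 1).

(* Main.v *)
Require Import Defs.
From mathcomp Require Import all_boot all_order all_algebra.
From mathcomp Require Import all_classical all_reals all_analysis.
From mathcomp Require Import measurable_realfun ring lra.
Import Order.TTheory GRing.Theory Num.Theory.
Import numFieldNormedType.Exports.
Local Open Scope classical_set_scope.
Local Open Scope ring_scope.

(** The mean is exactly [pi / 2], because a symmetry of the domain turns every
    angle [gamma] into [pi - gamma].

    Let [H] be the orthogonal reflection across the line spanned by [x], and
    consider [A |-> - (H * A * H)].  Since [H] fixes [x], the image of [x] under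
    the new operator is the mirror image of [A x] in the line orthogonal to
    [x], so that [gamma] becomes [pi - gamma] (for [gamma] between [0] and
    [pi]).  Writing [A] as a similarity plus an anti-similarity of the plane,
    the map changes the sign of [a + d], keeps [c - b], and rotates or reflects
    the pair [(a - d, b + c)]; hence it preserves the inequalities that define
    the domain ([Gplus_anti_conj]).  It preserves Lebesgue measure
    ([lebesgue4_anti_conj]): left and right multiplications by a reflection are
    compositions of shears and sign changes of coordinates, each of which
    preserves a product measure by Fubini and by the invariance of Lebesgue
    measure on the line under translations and sign changes.

    Two facts make the angles explicit.  On matrices with complex spectrum, the
    polar angle can be taken in [0, pi] exactly when [b < c], and it then lies
    strictly inside ([polar_angle_open], [polar_angle_exists]).  The cross
    product of [x] and [A x] is then positive, as a definite quadratic form in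
    [x] ([image_cross_gt0]).  So [A x] lies strictly to the left of [x], and
    [gamma] is the arc cotangent of the quotient of the dot product by the cross
    product ([turn_angleE]).  This gives the measurability of [gamma], and its
    behaviour under the symmetry: the dot product changes sign and the cross
    product does not.  Finally the domain has finite and positive measure, so
    that the quotient of integrals is meaningful. *)

(** * Maps that preserve a product measure *)

Definition measure_preserving {d} {T : measurableType d} {R : realType}
    (m : set T -> \bar R) (f : T -> T) : Prop :=
  measurable_fun setT f /\ forall A, measurable A -> m (f @^-1` A) = m A.

Section measure_preserving_maps.
Context {d : measure_display} {T : measurableType d} {R : realType}.

Lemma measure_preserving_id (m : set T -> \bar R) : measure_preserving m id.
Proof. by split => [|A mA]; [exact: measurable_id|rewrite preimage_id]. Qed.

Lemma measure_preserving_comp (m : set T -> \bar R) (f g : T -> T) :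
  measure_preserving m f -> measure_preserving m g ->
  measure_preserving m (f \o g).
Proof.
move=> [mf pf] [mg pg]; split; first exact: measurableT_comp.
move=> A mA; rewrite comp_preimage pg ?pf//.
by rewrite -[X in measurable X]setTI; exact: mf.
Qed.

End measure_preserving_maps.

Section product_maps.
Context {d : measure_display} {T : measurableType d} {R : realType}.

Lemma measure_preserving_swap (m : {sigma_finite_measure set T -> \bar R}) :
  measure_preserving (m \x m)%E (fun z : T * T => (z.2, z.1)).
Proof.
have msw : measurable_fun setT (fun z : T * T => (z.2, z.1)).
  exact: measurable_swap.
split=> // A mA; symmetry.
pose m' : {measure set (T * T) -> \bar R} :=
  pushforward (m \x m)%E (fun z : T * T => (z.2, z.1)).
change ((m \x m)%E A = m' msw A).
apply: product_measure_unique => // B C mB mC.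
change ((m \x m)%E ((fun z : T * T => (z.2, z.1)) @^-1` (B `*` C)) =
  m B * m C)%E.
rewrite (_ : _ @^-1` _ = C `*` B); last by apply/seteqP; split=> -[x y] [].
by rewrite product_measure1E//= muleC.
Qed.

(** Fubini: the preimage of a set meets each vertical fibre in the preimage of
    the section of the set under a measure-preserving map of that fibre. *)
Lemma measure_preserving_skew
    (m1 m2 : {sigma_finite_measure set T -> \bar R}) (g : T -> T -> T) :
  measurable_fun setT (fun z : T * T => g z.1 z.2) ->
  (forall x, measure_preserving m2 (g x)) ->
  measure_preserving (m1 \x m2)%E (fun z : T * T => (z.1, g z.1 z.2)).
Proof.
move=> mg pg.
have mf : measurable_fun setT (fun z : T * T => (z.1, g z.1 z.2)).
  by apply: measurable_fun_pair => //; exact: measurable_fst.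
split=> // A mA; rewrite /product_measure1; apply: eq_integral => x _ /=.
rewrite -[RHS](pg x).2; last exact: measurable_xsection.
by congr (m2 _); apply/seteqP; split=> y; rewrite /xsection/= !inE.
Qed.

Lemma measure_preserving_skewl (m : {sigma_finite_measure set T -> \bar R})
    (g : T -> T -> T) :
  measurable_fun setT (fun z : T * T => g z.1 z.2) ->
  (forall x, measure_preserving m (g x)) ->
  measure_preserving (m \x m)%E (fun z : T * T => (g z.2 z.1, z.2)).
Proof.
move=> mg pg.
have -> : (fun z : T * T => (g z.2 z.1, z.2)) =
    (fun z : T * T => (z.2, z.1)) \o (fun z : T * T => (z.1, g z.1 z.2)) \o
    (fun z : T * T => (z.2, z.1)) by [].
apply: measure_preserving_comp; last exact: measure_preserving_swap.
by apply: measure_preserving_comp; [exact: measure_preserving_swap|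
  exact: measure_preserving_skew].
Qed.

Lemma measure_preserving_prod (m : {sigma_finite_measure set T -> \bar R})
    (f g : T -> T) :
  measure_preserving m f -> measure_preserving m g ->
  measure_preserving (m \x m)%E (fun z : T * T => (f z.1, g z.2)).
Proof.
move=> pf pg.
have -> : (fun z : T * T => (f z.1, g z.2)) =
  (fun z : T * T => (f z.1, z.2)) \o (fun z : T * T => (z.1, g z.2)) by [].
apply: measure_preserving_comp.
  apply: (measure_preserving_skewl m (fun _ => f)) => //.
  exact: measurableT_comp pf.1 measurable_snd.
apply: (measure_preserving_skew m m (fun _ => g)) => //.
exact: measurableT_comp pg.1 measurable_snd.
Qed.

(** The function [h] plays the part of [h t u v = v + t u].  The composite is
    the conjugate of the upper triangular involution [(u, v) |-> (u + s v, - v)] by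
    the shear [(u, v) |-> (u, v + t u)].  The abstract [h] allows [u] and [v] to
    be numbers as well as rows of a matrix. *)
Lemma measure_preserving_sheared_flip
    (m : {sigma_finite_measure set T -> \bar R}) (h : R -> T -> T -> T)
    (o : T -> T) (s t : R) :
  (forall t, measurable_fun setT (fun z : T * T => h t z.1 z.2)) ->
  (forall t u, measure_preserving m (h t u)) ->
  measure_preserving m o ->
  measure_preserving (m \x m)%E
    ((fun z : T * T => (z.1, h t z.1 z.2)) \o
     (fun z : T * T => (z.1, o z.2)) \o
     (fun z : T * T => (h s z.2 z.1, z.2)) \o
     (fun z : T * T => (z.1, h (- t) z.1 z.2))).
Proof.
move=> mh ph po; do 3?[apply: measure_preserving_comp].
- exact: measure_preserving_skew.
- exact: (measure_preserving_prod _ id o (measure_preserving_id _)).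
- exact: measure_preserving_skewl.
- exact: measure_preserving_skew.
Qed.

End product_maps.

(** * Reflections preserve Lebesgue measure *)

Section lebesgue_line_maps.
Context {R : realType}.
Local Notation mR := (measurableTypeR R).

Lemma lebesgue_translation (b : R) :
  measure_preserving (@lebesgue_measure R) (fun u : mR => u + b : mR).
Proof.
have mf : measurable_fun setT (fun u : mR => u + b : mR).
  apply: measurable_funD; last exact: measurable_cst.
  exact: measurable_id.
split=> // A mA; symmetry.
pose m' : {measure set mR -> \bar R} :=
  pushforward (@lebesgue_measure R) (fun u : mR => u + b : mR).
change (lebesgue_measure A = m' mf A).
apply: lebesgue_measure_unique => // _ [[x y] _ <-].
change (lebesgue_measure `]x, y]%classic =
  lebesgue_measure ((fun u : mR => u + b : mR) @^-1` `]x, y]%classic)).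
rewrite (_ : _ @^-1` _ = `]x - b, y - b]%classic); last first.
  by apply/seteqP; split=> u /=; rewrite !in_itv/= ltrBlDr lerBrDr.
rewrite !lebesgue_measure_itv/= !lte_fin ltrD2r.
by case: ifP => // _; rewrite -!EFinB opprB addrA subrK.
Qed.

Lemma lebesgue_opp :
  measure_preserving (@lebesgue_measure R) (fun u : mR => - u : mR).
Proof.
have mf : measurable_fun setT (fun u : mR => - u : mR).
  exact/measurable_funN/measurable_id.
split=> // A mA; symmetry.
pose m' : {measure set mR -> \bar R} :=
  pushforward (@lebesgue_measure R) (fun u : mR => - u : mR).
change (lebesgue_measure A = m' mf A).
apply: lebesgue_measure_unique => // _ [[x y] _ <-].
change (lebesgue_measure `]x, y]%classic =
  lebesgue_measure ((fun u : mR => - u : mR) @^-1` `]x, y]%classic)).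
rewrite (_ : _ @^-1` _ = `[- y, - x[%classic); last first.
  by apply/seteqP; split=> u /=; rewrite !in_itv/= ltrNr lerNl andbC.
rewrite !lebesgue_measure_itv/= !lte_fin ltrN2.
by case: ifP => // _; rewrite -!EFinB opprK addrC.
Qed.

End lebesgue_line_maps.

Section lebesgue_reflections.
Context {R : realType}.
Local Notation mR := (measurableTypeR R).

(** Right multiplication of the row [z] by the symmetric matrix of rows [(k, s)]
    and [(s, - k)]; the orthogonal reflections across lines are the cases
    [k ^+ 2 + s ^+ 2 = 1]. *)
Definition plane_reflection (k s : R) (z : mR * mR) : mR * mR :=
  (k * z.1 + s * z.2, s * z.1 - k * z.2).

(** Left multiplication of the matrix [v] by the same symmetric matrix. *)
Definition row_reflection (k s : R) (v : R4 R) : R4 R :=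
  ((k * v.1.1 + s * v.2.1, k * v.1.2 + s * v.2.2),
   (s * v.1.1 - k * v.2.1, s * v.1.2 - k * v.2.2)).

Let shear (t : R) (u v : mR) : mR := v + t * u.

Let measurable_shear t :
  measurable_fun setT (fun z : mR * mR => shear t z.1 z.2).
Proof.
apply: measurable_funD; first exact: measurable_snd.
apply: measurable_funM; first exact: measurable_cst.
exact: measurable_fst.
Qed.

Let shear2 (t : R) (u v : mR * mR) : mR * mR :=
  (shear t u.1 v.1, shear t u.2 v.2).

Let measurable_shear2 t :
  measurable_fun setT
    (fun z : (mR * mR) * (mR * mR) => shear2 t z.1 z.2).
Proof.
have m (f : mR * mR -> mR) : measurable_fun setT f ->
    measurable_fun setT (fun z : (mR * mR) * (mR * mR) =>
      shear t (f z.1) (f z.2)).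
  move=> mf; apply: (measurableT_comp (measurable_shear t)
    (g := fun z : (mR * mR) * (mR * mR) => (f z.1, f z.2))).
  apply: measurable_fun_pair; apply: (measurableT_comp mf).
    exact: measurable_fst.
  exact: measurable_snd.
by apply: measurable_fun_pair;
  [exact: (m _ measurable_fst)|exact: (m _ measurable_snd)].
Qed.

Let lebesgue2_opp : measure_preserving (@lebesgue2 R)
  (fun z : mR * mR => (- z.1, - z.2) : mR * mR).
Proof. exact: measure_preserving_prod lebesgue_opp lebesgue_opp. Qed.

(** With [t = s / (1 + k)] the axis of the reflection is spanned by [(1, t)],
    and the shear [(u, v) |-> (u, v + t u)] takes the first coordinate axis to
    it.  No such shear exists for [k = - 1], when the axis is vertical. *)
Lemma lebesgue2_reflection (k s : R) : k ^+ 2 + s ^+ 2 = 1 ->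
  measure_preserving (@lebesgue2 R) (plane_reflection k s).
Proof.
move=> ks1; have [k1|k1] := eqVneq (1 + k) 0.
  have {k1}kE : k = -1 by lra.
  have sE : s = 0 by apply/eqP; rewrite -sqrf_eq0; apply/eqP; nra.
  have -> : plane_reflection k s = (fun z : mR * mR => (- z.1, id z.2)).
    by apply/funext => -[u v]; rewrite /plane_reflection kE sE; congr pair;
      rewrite /=; ring.
  exact: measure_preserving_prod lebesgue_opp (measure_preserving_id _).
have := @measure_preserving_sheared_flip _ _ _ (@lebesgue_measure R)
  shear _ s (s / (1 + k)) measurable_shear
  (fun t u => lebesgue_translation (t * u)) lebesgue_opp.
congr (measure_preserving _ _); apply/funext => -[u v].
have s2 : s ^+ 2 = 1 - k ^+ 2 by lra.
rewrite /plane_reflection /shear /=; congr pair; field: s2 => //.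
Qed.

Lemma lebesgue4_row_reflection (k s : R) : k ^+ 2 + s ^+ 2 = 1 ->
  measure_preserving (@lebesgue4 R) (row_reflection k s).
Proof.
move=> ks1; have [k1|k1] := eqVneq (1 + k) 0.
  have {k1}kE : k = -1 by lra.
  have sE : s = 0 by apply/eqP; rewrite -sqrf_eq0; apply/eqP; nra.
  have -> : row_reflection k s =
      (fun v : R4 R => ((- v.1.1, - v.1.2) : mR * mR, id v.2)).
    by apply/funext => -[[a b] [c d]]; rewrite /row_reflection kE sE;
      congr (pair (pair _ _) (pair _ _)); rewrite /=; ring.
  exact: measure_preserving_prod lebesgue2_opp (measure_preserving_id _).
have tr t (u : mR * mR) : measure_preserving (@lebesgue2 R) (shear2 t u).
  exact: measure_preserving_prod (lebesgue_translation _)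
    (lebesgue_translation _).
have := @measure_preserving_sheared_flip _ _ _ (@lebesgue2 R)
  shear2 _ s (s / (1 + k)) measurable_shear2 tr lebesgue2_opp.
congr (measure_preserving _ _); apply/funext => -[[a b] [c d]].
have s2 : s ^+ 2 = 1 - k ^+ 2 by lra.
by rewrite /row_reflection /shear2 /shear /=;
  congr (pair (pair _ _) (pair _ _)); field: s2.
Qed.

(** In matrix terms this is [A |-> - (H * A * H)], where [H] is the symmetric
    matrix with rows [(k, s)] and [(s, - k)]. *)
Definition anti_conj (k s : R) (v : R4 R) : R4 R :=
  row_reflection (- k) (- s)
    (plane_reflection k s v.1, plane_reflection k s v.2).

Lemma lebesgue4_anti_conj (k s : R) : k ^+ 2 + s ^+ 2 = 1 ->
  measure_preserving (@lebesgue4 R) (anti_conj k s).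
Proof.
move=> ks1; apply: measure_preserving_comp.
  by apply: lebesgue4_row_reflection; rewrite !sqrrN.
by apply: measure_preserving_prod; exact: lebesgue2_reflection.
Qed.

End lebesgue_reflections.

(** * Polar angle and turn angle of plane matrices *)

Section plane_matrices.
Context {R : realType}.
Implicit Types (a b c d alpha w u g : R) (x y : 'cV[R]_2) (B : 'M[R]_2).

Lemma mx2E B : B = mx2 (B 0 0) (B 0 1) (B 1 0) (B 1 1).
Proof.
apply/matrixP => -[[|[|i]] // hi] [[|[|j]] // hj]; rewrite mxE /=;
  by congr (B _ _); apply/val_inj.
Qed.

Lemma mx2_inj a b c d a' b' c' d' :
  mx2 a b c d = mx2 a' b' c' d' -> [/\ a = a', b = b', c = c' & d = d'].
Proof.
move=> /matrixP e.
by have := e 0 0; have := e 0 1; have := e 1 0; have := e 1 1; rewrite !mxE.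
Qed.

Lemma tr_mx2 a b c d : (mx2 a b c d)^T = mx2 a c b d.
Proof. by rewrite [LHS]mx2E !mxE. Qed.

Lemma mul_mx2 a b c d a' b' c' d' : mx2 a b c d *m mx2 a' b' c' d' =
  mx2 (a * a' + b * c') (a * b' + b * d') (c * a' + d * c') (c * b' + d * d').
Proof. by rewrite [LHS]mx2E !mxE !big_ord_recl !big_ord0 !mxE /= !addr0. Qed.

Lemma mul_mx2_cV a b c d x : mx2 a b c d *m x =
  \col_i (if i == 0 then a * x 0 0 + b * x 1 0 else c * x 0 0 + d * x 1 0).
Proof.
apply/matrixP => -[[|[|i]] // hi] j; rewrite !mxE !big_ord_recl big_ord0 !mxE;
  rewrite (ord1 j) /= addr0; congr (_ * x _ _ + _ * x _ _);
  exact/val_inj.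
Qed.

Lemma cV2P x y : x 0 0 = y 0 0 -> x 1 0 = y 1 0 -> x = y.
Proof.
move=> e0 e1; apply/matrixP => i j; rewrite (ord1 j).
by case: i => -[|[|i]] // hi; [move: e0|move: e1]; congr (x _ _ = y _ _);
  apply/val_inj.
Qed.

Lemma qf_mx2 a b c d x : (x^T *m mx2 a b c d *m x) 0 0 =
  a * x 0 0 ^+ 2 + (b + c) * (x 0 0 * x 1 0) + d * x 1 0 ^+ 2.
Proof.
rewrite -mulmxA mul_mx2_cV mxE !big_ord_recl big_ord0 !mxE /=.
rewrite (_ : lift ord0 ord0 = 1); last exact/val_inj.
by rewrite (_ : ord0 = 0) //=; ring.
Qed.

Lemma cV2_norm_gt0 x : x != 0 -> 0 < x 0 0 ^+ 2 + x 1 0 ^+ 2.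
Proof.
move=> x0; rewrite lt_neqAle addr_ge0 ?sqr_ge0// andbT eq_sym.
apply: contraNneq x0 => /eqP; rewrite paddr_eq0 ?sqr_ge0// !sqrf_eq0.
by move=> /andP[/eqP e0 /eqP e1]; apply/eqP/cV2P; rewrite mxE.
Qed.

Lemma sym_posdef_mx2 a b d : 0 < a + d -> b ^+ 2 < a * d ->
  sym_posdef (mx2 a b b d).
Proof.
move=> tr_gt0 det_gt0; split; first exact: tr_mx2.
move=> x /cV2_norm_gt0; rewrite qf_mx2.
have a0 : 0 < a by nra.
set u := x 0 0; set v := x 1 0 => uv.
rewrite -(pmulr_rgt0 _ a0).
have -> : a * (a * u ^+ 2 + (b + b) * (u * v) + d * v ^+ 2) =
  (a * u + b * v) ^+ 2 + (a * d - b ^+ 2) * v ^+ 2 by ring.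
have [v0|v0] := eqVneq v 0.
  move: uv; rewrite v0 expr0n /= !(mulr0, addr0) => uv.
  by rewrite exprMn; apply: mulr_gt0 => //; exact: exprn_gt0.
by rewrite ltr_wpDl ?sqr_ge0// mulr_gt0 ?subr_gt0// exprn_even_gt0.
Qed.

Lemma sym_posdef_diag_gt0 B : sym_posdef B ->
  [/\ 0 < B 0 0, 0 < B 1 1 & B 0 1 = B 1 0].
Proof.
move=> [Bsym Bpos]; split; last first.
- by rewrite -[in LHS]Bsym mxE.
- have := Bpos (\col_i (i == 1)%:R); rewrite {1}[B]mx2E qf_mx2 !mxE /=.
  rewrite !mul0r !expr0n !mulr0 !add0r expr1n mulr1; apply.
  by apply/eqP => /matrixP/(_ 1 0); rewrite !mxE /= => /eqP; rewrite oner_eq0.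
- have := Bpos (\col_i (i == 0)%:R); rewrite {1}[B]mx2E qf_mx2 !mxE /=.
  rewrite !mulr0 !expr0n !mulr0 !addr0 expr1n mulr1; apply.
  by apply/eqP => /matrixP/(_ 0 0); rewrite !mxE /= => /eqP; rewrite oner_eq0.
Qed.

(** In [rot2 alpha *m B] the difference of the off-diagonal entries is
    [sin alpha * \tr B], where [\tr B > 0], and complex spectrum keeps it away
    from [0]. *)
Lemma polar_angle_open a b c d alpha : (a - d) ^+ 2 + 4 * b * c < 0 ->
  0 <= alpha <= pi -> is_polar_angle (mx2 a b c d) alpha ->
  b < c /\ 0 < alpha < pi.
Proof.
move=> spec /andP[alpha0 alphapi] [B [/sym_posdef_diag_gt0[]]].
rewrite [B]mx2E; set e := B 0 0; set f := B 0 1; set f' := B 1 0.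
set h := B 1 1; rewrite !mxE /= => e0 h0 ff' _.
rewrite /rot2 mul_mx2 => /mx2_inj[aE bE cE dE].
have cbE : c - b = sin alpha * (e + h) by rewrite bE cE ff'; ring.
have sin_neq0 : sin alpha != 0.
  apply/eqP => s0; move: cbE; rewrite s0 mul0r => cb.
  have {cb}cb : c = b by lra.
  by move: spec (sqr_ge0 (a - d)) (sqr_ge0 b); rewrite cb; nra.
have sin_gt0 : 0 < sin alpha.
  rewrite lt_neqAle eq_sym sin_neq0 /=.
  by apply: sin_ge0_pi; rewrite alpha0.
split; first by rewrite -subr_gt0 cbE mulr_gt0// addr_gt0.
rewrite !lt_neqAle alpha0 alphapi !andbT; apply/andP; split.
  by apply: contraNneq sin_neq0 => <-; rewrite sin0.
by apply: contraNneq sin_neq0 => ->; rewrite sinpi.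
Qed.

(** This [g] is the arc cotangent of [w / u], that is, the argument of the
    complex number [w + i u]. *)
Lemma cot_angle w u : 0 < u -> let g := pi / 2 - atan (w / u) in
  [/\ 0 < g < pi, 0 < sin g & cos g * u = sin g * w].
Proof.
move=> u0 g; set t := atan (w / u) in g *.
have lo : - (pi / 2) < t := atan_gtNpi2 _.
have hi : t < pi / 2 := atan_ltpi2 _.
have c0 : 0 < cos t by rewrite cos_gt0_pihalf// lo.
have sg : sin g = cos t by rewrite /g -opprB sinN sinBpihalf opprK.
have cg : cos g = sin t by rewrite /g -opprB cosN cosBpihalf.
have tt : tan t = w / u := atanK _.
have cw : sin t = w / u * cos t by rewrite -tt /tan divfK ?gt_eqF.
split; [by rewrite /g; lra|by rewrite sg|].
by rewrite cg sg cw mulrAC divfK ?gt_eqF// mulrC.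
Qed.

(** In the window from [- pi] to [2 pi] the sine is positive only between [0]
    and [pi], where the cotangent is injective. *)
Lemma cot_angle_unique w u g : 0 < u -> - pi < g < 2 * pi -> 0 < sin g ->
  cos g * u = sin g * w -> g = pi / 2 - atan (w / u).
Proof.
move=> u0 /andP[lo hi] s0 e.
have g0 : 0 < g.
  rewrite ltNge; apply/negP => g0.
  have : 0 <= sin (g + pi) by apply: sin_ge0_pi; lra.
  by rewrite sinDpi; lra.
have gpi : g < pi.
  rewrite ltNge; apply/negP => gpi.
  have : 0 <= sin (g - pi) by apply: sin_ge0_pi; lra.
  by rewrite -[g in sin g](subrK pi) sinDpi in s0; lra.
have -> : w / u = tan (pi / 2 - g).
  rewrite /tan -[pi / 2 - g]opprB sinN cosN sinBpihalf cosBpihalf opprK.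
  by apply/eqP; rewrite eqr_div ?lt0r_neq0// e mulrC.
rewrite tanK; last by rewrite in_itv/=; lra.
by rewrite opprB addrC subrK.
Qed.

(** The angle is chosen so that [B = rot2 (- alpha) *m A] is symmetric, which
    means [cos alpha * (c - b) = sin alpha * (a + d)]; complex spectrum gives
    [\det B = \det A > 0], and [b < c] gives [\tr B > 0]. *)
Lemma polar_angle_exists a b c d : (a - d) ^+ 2 + 4 * b * c < 0 -> b < c ->
  exists2 alpha, 0 <= alpha <= pi & is_polar_angle (mx2 a b c d) alpha.
Proof.
move=> spec bc; have u0 : 0 < c - b by lra.
have /= := cot_angle (a + d) (c - b) u0.
set alpha := pi / 2 - _; set k := cos alpha; set s := sin alpha.
move=> [/andP[/ltW lo /ltW hi] s0 e]; exists alpha; first by rewrite lo.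
have ks : k ^+ 2 + s ^+ 2 = 1 := cos2Dsin2 alpha.
(* The two expressions for the off-diagonal entries of the rotated matrix. *)
have fE : k * b + s * d = k * c - s * a by lra.
exists (mx2 (k * a + s * c) (k * b + s * d) (k * b + s * d) (k * d - s * b)).
split.
- apply: sym_posdef_mx2.
    have -> : k * a + s * c + (k * d - s * b) =
        s * ((a + d) ^+ 2 + (c - b) ^+ 2) / (c - b).
      apply: (mulIf (lt0r_neq0 u0)); rewrite divfK ?gt_eqF//.
      transitivity (k * (c - b) * (a + d) + s * (c - b) ^+ 2); first by ring.
      by rewrite e; ring.
    rewrite divr_gt0// mulr_gt0// ltr_wpDl ?sqr_ge0//.
    by rewrite exprn_gt0.
  rewrite -subr_gt0 expr2 {2}fE.
  have -> : (k * a + s * c) * (k * d - s * b) -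
    (k * b + s * d) * (k * c - s * a) = (k ^+ 2 + s ^+ 2) * (a * d - b * c).
    by ring.
  rewrite ks mul1r; move: spec (sqr_ge0 (a + d)); nra.
- rewrite tr_mx2 !mul_mx2; congr mx2.
  + rewrite {1 2}fE.
    by transitivity ((k ^+ 2 + s ^+ 2) * (a * a + c * c)); [ring|
      rewrite ks mul1r].
  + rewrite {2}fE.
    by transitivity ((k ^+ 2 + s ^+ 2) * (a * b + c * d)); [ring|
      rewrite ks mul1r].
  + rewrite {2}fE.
    by transitivity ((k ^+ 2 + s ^+ 2) * (b * a + d * c)); [ring|
      rewrite ks mul1r].
  + by transitivity ((k ^+ 2 + s ^+ 2) * (b * b + d * d)); [ring|
      rewrite ks mul1r].
- rewrite /rot2 mul_mx2 -/k -/s; congr mx2.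
  + rewrite fE.
    by transitivity ((k ^+ 2 + s ^+ 2) * a); [rewrite ks mul1r|ring].
  + by transitivity ((k ^+ 2 + s ^+ 2) * b); [rewrite ks mul1r|ring].
  + rewrite fE.
    by transitivity ((k ^+ 2 + s ^+ 2) * c); [rewrite ks mul1r|ring].
  + by transitivity ((k ^+ 2 + s ^+ 2) * d); [rewrite ks mul1r|ring].
Qed.

Definition image_dot x (v : R4 R) : R :=
  x 0 0 * (v.1.1 * x 0 0 + v.1.2 * x 1 0) +
  x 1 0 * (v.2.1 * x 0 0 + v.2.2 * x 1 0).

Definition image_cross x (v : R4 R) : R :=
  x 0 0 * (v.2.1 * x 0 0 + v.2.2 * x 1 0) -
  x 1 0 * (v.1.1 * x 0 0 + v.1.2 * x 1 0).

(** [image_cross] is a quadratic form in [x] whose discriminant is negative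
    exactly when the spectrum is complex, and its coefficient at the square of
    the first coordinate is [c > 0]. *)
Lemma image_cross_gt0 a b c d x : (a - d) ^+ 2 + 4 * b * c < 0 -> b < c ->
  x != 0 -> 0 < image_cross x ((a, b), (c, d)).
Proof.
move=> spec bc /cV2_norm_gt0; rewrite /image_cross /=.
set p := x 0 0; set q := x 1 0 => pq.
have c0 : 0 < c.
  by rewrite ltNge; apply/negP => c0; move: spec (sqr_ge0 (a - d)); nra.
have c4 : 0 < 4 * c by lra.
rewrite -(pmulr_rgt0 _ c4).
have -> : 4 * c * (p * (c * p + d * q) - q * (a * p + b * q)) =
  (2 * c * p + (d - a) * q) ^+ 2 - ((a - d) ^+ 2 + 4 * b * c) * q ^+ 2.
  by ring.
have [q0|q0] := eqVneq q 0.
  move: pq; rewrite q0 expr0n /= !(mulr0, addr0, subr0) => pq.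
  by rewrite exprMn; apply: mulr_gt0 => //; rewrite exprn_gt0// mulr_gt0.
rewrite -mulNr ltr_wpDl ?sqr_ge0// mulr_gt0 ?oppr_gt0//.
by rewrite exprn_even_gt0.
Qed.

(** Identifying [x] with a complex number, the dot and cross products are the
    real and imaginary parts of the quotient [A x / x], up to the factor
    [|x|^2]. *)
Lemma oriented_angle_image a b c d x g : x != 0 ->
  is_oriented_angle x (mx2 a b c d *m x) g <->
  exists2 k, 0 < k & k * cos g = image_dot x ((a, b), (c, d)) /\
                     k * sin g = image_cross x ((a, b), (c, d)).
Proof.
move=> /cV2_norm_gt0; rewrite /is_oriented_angle /rot2 !mul_mx2_cV.
rewrite /image_dot /image_cross /=.
set p := x 0 0; set q := x 1 0; set n := _ + _ => n0; split.
  move=> [k k0 /matrixP e]; exists (k * n); first exact: mulr_gt0.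
  have := e 0 0; have := e 1 0; rewrite !mxE /= => -> ->.
  by split; rewrite /n; ring.
move=> [k k0 [e1 e2]]; exists (k / n); first exact: divr_gt0.
have kn : k = k / n * n by rewrite divfK ?gt_eqF.
apply: cV2P; rewrite !mxE /=; apply: (mulIf (lt0r_neq0 n0)).
  transitivity ((k * cos g) * p - (k * sin g) * q).
    by rewrite e1 e2 /n; ring.
  by rewrite [in LHS]kn; ring.
transitivity ((k * cos g) * q + (k * sin g) * p).
  by rewrite e1 e2 /n; ring.
by rewrite [in LHS]kn; ring.
Qed.

(** The polar angle [alpha] lies strictly between [0] and [pi], hence the window
    from [alpha - pi] to [alpha + pi] contains the arc cotangent and is
    contained in the window of [cot_angle_unique]. *)
Lemma turn_angleE a b c d x : (a - d) ^+ 2 + 4 * b * c < 0 -> b < c ->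
  x != 0 -> turn_angle x (mx2 a b c d) =
  pi / 2 - atan (image_dot x ((a, b), (c, d)) / image_cross x ((a, b), (c, d))).
Proof.
move=> spec bc x0.
have D0 := image_cross_gt0 _ _ _ _ _ spec bc x0.
have [al al0 alA] := polar_angle_exists _ _ _ _ spec bc.
have [] := getI (P := [set alpha : R | 0 <= alpha <= pi /\
  is_polar_angle (mx2 a b c d) alpha]) (conj al0 alA).
rewrite -/(polar_angle _) => be0 /(polar_angle_open _ _ _ _ _ spec be0).
move=> [_ /andP[lo hi]].
have /= := cot_angle (image_dot x ((a, b), (c, d))) _ D0.
set g0 := pi / 2 - _ => -[/andP[g0lo g0hi] s0 e].
apply: get_unique.
  split; first by lra.
  apply/oriented_angle_image => //.
  exists (image_cross x ((a, b), (c, d)) / sin g0); first exact: divr_gt0.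
  rewrite divfK ?gt_eqF//; split=> //.
  apply: (mulIf (lt0r_neq0 s0)).
  by rewrite mulrAC divfK ?gt_eqF// mulrC e mulrC.
move=> g [/andP[glo ghi] /(oriented_angle_image _ _ _ _ _ _ x0)[k k0 [e1 e2]]].
apply: cot_angle_unique => //; first by lra.
  by rewrite -(pmulr_rgt0 _ k0) e2.
apply: (mulfI (lt0r_neq0 k0)).
by rewrite !mulrA e1 e2 mulrC.
Qed.

End plane_matrices.

(** * The symmetry of the domain and the mean angle *)

(** The substitution [phi] shows that the integral equals its opposite. *)
Lemma Rintegral_odd {d} {T : measurableType d} {R : realType}
    (m : {measure set T -> \bar R}) (phi : T -> T) (D : set T) (f : T -> R) :
  measure_preserving m phi -> measurable D -> phi @^-1` D = D ->
  measurable_fun setT f -> m.-integrable D (EFin \o f) ->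
  (forall v, f (phi v) = - f v) ->
  \int[m]_(v in D) f v = 0.
Proof.
move=> [mphi pphi] mD Dphi mf intf odd.
suff : \int[m]_(v in D) f v = - \int[m]_(v in D) f v by lra.
have fphi : (EFin \o f) \o phi = (\- (EFin \o f))%E.
  by apply/funext => v /=; rewrite odd.
have intN : m.-integrable D ((EFin \o f) \o phi).
  by rewrite fphi; exact: integrableN.
rewrite -mulN1r -RintegralZl// /Rintegral.
congr fine; transitivity (\int[pushforward m phi]_(v in D) (f v)%:E)%E.
  by apply: eq_measure_integral => A mA _; rewrite -(pphi _ mA).
have /measurable_EFinP mEf := mf.
by rewrite (integral_pushforward mphi mEf _ mD) Dphi//;
  apply: eq_integral => v _ /=; rewrite odd mulN1r.
Qed.

Section spectral_domain.
Context {R : realType}.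
Local Notation mR := (measurableTypeR R).

(** The condition on the polar angle becomes [b < c]; in this form the domain is
    visibly measurable. *)
Lemma GplusE : @Gplus R = [set v | [/\
  (v.1.1 - v.2.2) ^+ 2 + 4 * v.1.2 * v.2.1 < 0,
  2^-1 * ((v.1.1 - v.2.2) ^+ 2 + (v.1.2 + v.2.1) ^+ 2) < 1,
  2^-1 * ((v.1.1 + v.2.2) ^+ 2 + (v.1.2 - v.2.1) ^+ 2) < 1
  & v.1.2 < v.2.1]].
Proof.
apply/seteqP; split=> -[[a b] [c d]] /= [spec q1 p1].
  by move=> [al al0 /(polar_angle_open _ _ _ _ _ spec al0)[]].
by move=> bc; split=> //; exact: polar_angle_exists.
Qed.

(** The map negates [a + d], fixes [b - c] and acts on [(a - d, b + c)] by an
    isometry; the discriminant [(a - d) ^+ 2 + 4 * b * c] is the difference of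
    the squared norms of [(a - d, b + c)] and [b - c]. *)
Lemma Gplus_anti_conj (k s : R) : k ^+ 2 + s ^+ 2 = 1 ->
  anti_conj k s @^-1` Gplus = Gplus.
Proof.
move=> ks; rewrite GplusE; apply: eq_set => -[[a b] [c d]] /=.
rewrite /anti_conj /row_reflection /plane_reflection /=.
set a' := - k * (k * a + s * b) + - s * (k * c + s * d).
set b' := - k * (s * a - k * b) + - s * (s * c - k * d).
set c' := - s * (k * a + s * b) - - k * (k * c + s * d).
set d' := - s * (s * a - k * b) - - k * (s * c - k * d).
have trE : a' + d' = - (a + d).
  transitivity (- (k ^+ 2 + s ^+ 2) * (a + d)); first by rewrite /a' /d'; ring.
  by rewrite ks mulN1r.
have asE : b' - c' = b - c.
  transitivity ((k ^+ 2 + s ^+ 2) * (b - c)); first by rewrite /b' /c'; ring.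
  by rewrite ks mul1r.
have qE : (a' - d') ^+ 2 + (b' + c') ^+ 2 = (a - d) ^+ 2 + (b + c) ^+ 2.
  transitivity ((k ^+ 2 + s ^+ 2) ^+ 2 * ((a - d) ^+ 2 + (b + c) ^+ 2)).
    by rewrite /a' /b' /c' /d'; ring.
  by rewrite ks expr1n mul1r.
have specE (e f g h : R) : (e - h) ^+ 2 + 4 * f * g =
  (e - h) ^+ 2 + (f + g) ^+ 2 - (f - g) ^+ 2 by ring.
rewrite !specE qE trE asE sqrrN.
by rewrite -(subr_lt0 c' b') -(subr_lt0 c b) asE.
Qed.

Lemma measurable_coord :
  [/\ measurable_fun setT (fun v : R4 R => v.1.1 : R),
      measurable_fun setT (fun v : R4 R => v.1.2 : R),
      measurable_fun setT (fun v : R4 R => v.2.1 : R) &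
      measurable_fun setT (fun v : R4 R => v.2.2 : R)].
Proof.
split.
- exact: measurableT_comp measurable_fst measurable_fst.
- exact: measurableT_comp measurable_snd measurable_fst.
- exact: measurableT_comp measurable_fst measurable_snd.
- exact: measurableT_comp measurable_snd measurable_snd.
Qed.

Lemma measurable_lt_set {d} {T : measurableType d} (f g : T -> R) :
  measurable_fun setT f -> measurable_fun setT g ->
  measurable [set v | f v < g v].
Proof.
move=> mf mg; have := measurable_fun_ltr mf mg.
move=> /(_ measurableT [set true] I); rewrite setTI.
by congr (measurable _); apply/seteqP; split=> v.
Qed.

Lemma measurable_Gplus : measurable (@Gplus R).
Proof.
rewrite GplusE; have [ma mb mc md] := measurable_coord.
rewrite (_ : [set v | _] =
  [set v : R4 R | (v.1.1 - v.2.2) ^+ 2 + 4 * v.1.2 * v.2.1 < 0] `&`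
  [set v : R4 R | 2^-1 * ((v.1.1 - v.2.2) ^+ 2 + (v.1.2 + v.2.1) ^+ 2) < 1] `&`
  [set v : R4 R | 2^-1 * ((v.1.1 + v.2.2) ^+ 2 + (v.1.2 - v.2.1) ^+ 2) < 1] `&`
  [set v : R4 R | v.1.2 < v.2.1]); last first.
  by apply/seteqP; split=> v /=; [case|move=> [[[]]]].
do 3?[apply: measurableI]; apply: measurable_lt_set => //;
  do ?[exact: measurable_cst | apply: measurable_funX | apply: measurable_funB
      | apply: measurable_funD | apply: measurable_funM | by []].
Qed.

Lemma lebesgue4_box (I J K L : interval R) :
  lebesgue4 (([set` I] `*` [set` J]) `*` ([set` K] `*` [set` L])) =
  (lebesgue_measure [set` I] * lebesgue_measure [set` J] *
   (lebesgue_measure [set` K] * lebesgue_measure [set` L]))%E.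
Proof.
have m (H : interval R) : measurable ([set` H] : set mR).
  exact: measurable_itv.
have E (H H' : interval R) : lebesgue2 ([set` H] `*` [set` H']) =
    (lebesgue_measure [set` H] * lebesgue_measure [set` H'])%E.
  exact: product_measure1E.
by rewrite -!E; apply: product_measure1E; exact: measurableX.
Qed.

Lemma lebesgue4_Gplus_lty : (lebesgue4 (@Gplus R) < +oo)%E.
Proof.
pose I : interval R := `[-2, 2].
apply: (@le_lt_trans _ _
    (lebesgue4 (([set` I] `*` [set` I]) `*` ([set` I] `*` [set` I])))).
  apply: le_measure; rewrite ?inE.
  - exact: measurable_Gplus.
  - by do 3?[apply: measurableX]; exact: measurable_itv.
  rewrite GplusE => -[[a b] [c d]] /= [_ q1 p1 _].
  (* The sum of the two quadratic inequalities that bound the domain. *)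
  have n2 : a ^+ 2 + b ^+ 2 + c ^+ 2 + d ^+ 2 < 2 by lra.
  have bd (e : R) : e ^+ 2 < 2 -> e \in I.
    by move=> e2; rewrite in_itv /=; apply/andP; split; nra.
  by move: (sqr_ge0 a) (sqr_ge0 b) (sqr_ge0 c) (sqr_ge0 d) => ? ? ? ?;
    split; split; apply: bd; lra.
rewrite lebesgue4_box lebesgue_measure_itv /= lte_fin.
by case: ifP => _; rewrite -?EFinM ?mule0 ltry.
Qed.

(** The domain contains a box with a vertex at the quarter turn scaled by one
    half, around which the defining inequalities are strict. *)
Lemma lebesgue4_Gplus_gt0 : (0 < lebesgue4 (@Gplus R))%E.
Proof.
pose e : R := 10^-1.
pose I : interval R := `[0, e].
pose J : interval R := `[- (6 * e), - (5 * e)].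
pose K : interval R := `[5 * e, 6 * e].
have eE : 10 * e = 1 by rewrite /e divff.
apply: (@lt_le_trans _ _
    (lebesgue4 (([set` I] `*` [set` J]) `*` ([set` K] `*` [set` I])))).
  rewrite lebesgue4_box !lebesgue_measure_itv /= !lte_fin.
  rewrite !ifT; [|lra..].
  by rewrite -!EFinD -!EFinM lte_fin; rewrite !mulr_gt0//; lra.
apply: le_measure; rewrite ?inE.
- by do 3?[apply: measurableX]; exact: measurable_itv.
- exact: measurable_Gplus.
rewrite GplusE => -[[a b] [c d]] /=; rewrite !in_itv /=.
move=> [[/andP[a0 a1] /andP[b0 b1]] [/andP[c0 c1] /andP[d0 d1]]].
split; nra.
Qed.

End spectral_domain.

Lemma mean_turn_angleE {R : realType} (x : 'cV[R]_2) : x != 0 ->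
  mean_turn_angle x = pi / 2.
Proof.
move=> x0; have n0 := cV2_norm_gt0 _ x0.
set p := x 0 0 in n0 *; set q := x 1 0 in n0 *; set n := _ + _ in n0 *.
(* The reflection across the line spanned by [x]. *)
pose k := (p ^+ 2 - q ^+ 2) / n; pose s := 2 * p * q / n.
have nn : n != 0 by rewrite gt_eqF.
have ks : k ^+ 2 + s ^+ 2 = 1 by rewrite /k /s /n; field.
have fixp : k * p + s * q = p by rewrite /k /s /n; field.
have fixq : s * p - k * q = q by rewrite /k /s /n; field.
have dotN v : image_dot x (anti_conj k s v) = - image_dot x v.
  case: v => -[a b] [c d].
  transitivity (- ((k * p + s * q) *
      (a * (k * p + s * q) + b * (s * p - k * q)) + (s * p - k * q) *
      (c * (k * p + s * q) + d * (s * p - k * q)))).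
    by rewrite /image_dot /anti_conj /row_reflection /plane_reflection /=
      -/p -/q; ring.
  by rewrite fixp fixq.
have crossK v : image_cross x (anti_conj k s v) = image_cross x v.
  case: v => -[a b] [c d].
  transitivity ((k * p + s * q) *
      (c * (k * p + s * q) + d * (s * p - k * q)) - (s * p - k * q) *
      (a * (k * p + s * q) + b * (s * p - k * q))).
    by rewrite /image_cross /anti_conj /row_reflection /plane_reflection /=
      -/p -/q; ring.
  by rewrite fixp fixq.
(* On the domain [f] is [pi / 2] minus the turn angle: there the cross product
   is positive, so its power [- 1] is its inverse. *)
pose f (v : R4 R) := atan (image_dot x v * image_cross x v `^ (-1)).
have [ma mb mc md] := @measurable_coord R.
have mf : measurable_fun setT f.
  apply: (measurableT_comp (continuous_measurable_fun (@continuous_atan R))).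
  apply: measurable_funM; last apply: (measurableT_comp (measurable_powR (-1)));
  do ?[exact: measurable_cst | apply: measurable_funB
      | apply: measurable_funD | apply: measurable_funM | by []].
have mG := @measurable_Gplus R.
have Goo := @lebesgue4_Gplus_lty R.
have intf : (@lebesgue4 R).-integrable Gplus (EFin \o f).
  apply: measurable_bounded_integrable => //; first exact: measurable_funTS.
  exists pi; split; first exact: num_real.
  move=> M piM v _ /=; rewrite ler_norml.
  have := atan_gtNpi2 (image_dot x v * image_cross x v `^ (-1)).
  have := atan_ltpi2 (image_dot x v * image_cross x v `^ (-1)).
  rewrite -/(f v); have := pi_gt0 R; lra.
have f0 : \int[@lebesgue4 R]_(v in Gplus) f v = 0.
  apply: (Rintegral_odd _ _ _ _ (lebesgue4_anti_conj k s ks)) => //.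
    exact: Gplus_anti_conj.
  by move=> v; rewrite /f dotN crossK mulNr atanN.
rewrite /mean_turn_angle (_ : Rintegral _ _ (fun v => turn_angle _ _) =
  \int[@lebesgue4 R]_(v in Gplus) (pi / 2 - f v)); last first.
  apply: eq_Rintegral => -[[a b] [c d]]; rewrite inE GplusE.
  move=> -[/= spec _ _ bc].
  rewrite turn_angleE// /f powR_inv1//.
  exact/ltW/image_cross_gt0.
rewrite RintegralB//; last first.
  apply: measurable_bounded_integrable => //.
  by apply: bounded_cst.
rewrite f0 subr0 !Rintegral_cst// mul1r mulfK// gt_eqF//.
by rewrite fine_gt0// lebesgue4_Gplus_gt0.
Qed.

Theorem theorem3 (R : realType) (x : 'cV[R]_2) (hx : x != 0) :
  pi / 2 - 2 / pi <= mean_turn_angle x <= pi / 2 + 2 / pi.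
Proof.
have pi2 : 0 <= 2 / pi :> R by rewrite divr_ge0// pi_ge0.
rewrite mean_turn_angleE//; lra.
Qed.
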